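(* Let $\mathbf{x}_1,\dots,\mathbf{x}_N\in\mathbb{R}^K$ be nonzero, let $\mathbf{T}$ be a real symmetric positive definite $K\times K$ matrix, let $\alpha_0>0$, and suppose that $P_N(S)<\frac{(1+\alpha_0)\dim(S)}{K}$ for every proper subspace $S\subseteq\mathbb{R}^K$. Let $\boldsymbol{\Sigma}_0$ be an arbitrary real symmetric positive definite $K\times K$ matrix and define, for $t\ge0$, $$\boldsymbol{\Sigma}_{t+1}=\frac{1}{1+\alpha_0}\frac KN\sum_{i=1}^N\frac{\mathbf{x}_i\mathbf{x}_i^T}{\mathbf{x}_i^T\boldsymbol{\Sigma}_t^{-1}\mathbf{x}_i}+\frac{\alpha_0}{1+\alpha_0}\mathbf{T}.$$ Then the sequence $\{\boldsymbol{\Sigma}_t\}$ converges to the global minimizer of the problem of minimizing $$L^{\mathrm{KL}}(\boldsymbol{\Sigma})=\log\det(\boldsymbol{\Sigma})+\frac KN\sum_{i=1}^N\log\left(\mathbf{x}_i^T\boldsymbol{\Sigma}^{-1}\mathbf{x}_i\right)+\alpha_0\left(\mathrm{Tr}(\boldsymbol{\Sigma}^{-1}\mathbf{T})+\log\det(\boldsymbol{\Sigma})\right)$$ over $\boldsymbol{\Sigma}\succcurlyeq\mathbf{0}$.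
   Context: $P_N(S)=\frac1N\sum_{i=1}^N 1_{\{\mathbf{x}_i\in S\}}$ is the proportion of samples lying in $S$. ''Proper subspace'' means a linear subspace $S$ with $1\le\dim S\le K-1$. A function on positive definite matrices is assigned the value $+\infty$ at a singular positive semidefinite matrix when it tends to $+\infty$ there, so the minimization over $\boldsymbol{\Sigma}\succcurlyeq\mathbf 0$ amounts to minimization over positive definite $\boldsymbol{\Sigma}$. *)

(* Defs.v *)
From HB Require Import structures.
From mathcomp Require Import all_boot all_order all_algebra.
From mathcomp Require Import all_classical all_reals all_analysis.

Set Implicit Arguments.
Unset Strict Implicit.
Unset Printing Implicit Defensive.

Import Order.TTheory GRing.Theory Num.Theory.
Import numFieldNormedType.Exports.

Local Open Scope classical_set_scope.
Local Open Scope ring_scope.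

Section Definitions.
Context {R : realType} {K : nat}.
Implicit Types (S T : 'M[R]_K) (v : 'cV[R]_K).

Definition quadform S v : R := (v^T *m S *m v) 0 0.

Definition posdefmx : set 'M[R]_K :=
  [set S | S^T = S /\ forall v, v != 0 -> 0 < quadform S v].

Definition possemidefmx : set 'M[R]_K :=
  [set S | S^T = S /\ forall v, 0 <= quadform S v].

(* Extension to the positive semidefinite cone of a function on positive
   definite matrices, by its lower limit along positive definite matrices. The
   lower limit is +oo exactly when f tends to +oo, so f is assigned the value
   +oo at the singular matrices where it tends to +oo. *)
Definition psd_extension (f : 'M[R]_K -> R) S : \bar R :=
  if S \in posdefmx then (f S)%:E
  else limf_einf (fun A => (f A)%:E) (within posdefmx (nbhs S)).

Definition is_global_minimizer (D : set 'M[R]_K) (f : 'M[R]_K -> \bar R) S :=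
  D S /\ forall A, D A -> (f S <= f A)%E.

Context {N : nat}.
Implicit Types (x : 'I_N -> 'cV[R]_K).

Definition sample_proportion x (V : {vspace 'cV[R]_K}) : R :=
  N%:R^-1 * \sum_(i < N) (x i \in V)%:R.

Definition LKL x T (alpha0 : R) S : R :=
  ln (\det S)
  + K%:R / N%:R * \sum_(i < N) ln (quadform (invmx S) (x i))
  + alpha0 * (\tr (invmx S *m T) + ln (\det S)).

Definition LKL_step x T (alpha0 : R) S : 'M[R]_K :=
  ((1 + alpha0)^-1 * (K%:R / N%:R)) *:
    (\sum_(i < N) (quadform (invmx S) (x i))^-1 *: (x i *m (x i)^T))
  + (alpha0 / (1 + alpha0)) *: T.

End Definitions.

(* Main.v *)
(** The map [F := LKL_step x T alpha0] is monotone for the Loewner order, and under scaling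
    [F (a S) = a F S + (1 - a) B] with [B := alpha0 / (1 + alpha0) T] positive
    definite.  Hence, if [F S = S] and [d S <= B], a sandwich [b S <= A <= a S]
    with [b <= 1 <= a] improves under [F] to the one where [a - 1] and [1 - b]
    are multiplied by [1 - d]: the iterates of every positive definite matrix
    converge geometrically to the fixed point, which is therefore unique.

    Existence: the iterates [S_t] started at [B] increase, so their inverses
    [Q_t] decrease to some [Q >= 0].  Split [S_{t+1} = W_t + M_t], with [W_t]
    collecting the samples in [ker Q]; [M_t] converges to some [M].  In
    [K = tr (Q_{t+1} W_t) + tr (Q_{t+1} M_t)] the first term is at most
    [K / (1 + alpha0)] times the proportion of samples in [ker Q], and the
    second tends to [tr (Q M) <= rank Q], because [M_t <= S_{t+1}] gives
    [Q M Q <= Q].  The subspace condition for [ker Q] forces [rank Q = K], and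
    [Q^-1] is a fixed point.

    Minimality: [F] decreases the objective strictly off fixed points
    (majorization, by [ln det X + ln det Y <= tr (X Y) - K]), so the limit of the
    iterates minimizes.  At a singular matrix the objective tends to [+oo]:
    [tr (A^-1 T)] tends to [+oo] and dominates [ln det A]. *)

Require Import Defs.
From mathcomp Require Import all_boot all_order all_algebra.
From mathcomp Require Import all_classical all_reals all_analysis.
From mathcomp Require Import ring lra.

Set Implicit Arguments.
Unset Strict Implicit.
Unset Printing Implicit Defensive.

Import Order.TTheory GRing.Theory Num.Theory.
Import numFieldNormedType.Exports.
Local Open Scope classical_set_scope.
Local Open Scope ring_scope.

(** * Quadratic forms, positive definite matrices and the Loewner order *)

Section QuadraticForms.
Context {R : realType}.

Definition dot {n} (u v : 'cV[R]_n) : R := (u^T *m v) 0 0.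

Lemma dotE n (u v : 'cV[R]_n) : dot u v = \sum_k u k 0 * v k 0.
Proof. by rewrite /dot mxE; apply: eq_bigr => k _; rewrite mxE. Qed.

Lemma dotC n (u v : 'cV[R]_n) : dot u v = dot v u.
Proof. by rewrite !dotE; apply: eq_bigr => k _; rewrite mulrC. Qed.

Lemma dotDr n (u v w : 'cV[R]_n) : dot u (v + w) = dot u v + dot u w.
Proof. by rewrite /dot mulmxDr mxE. Qed.

Lemma dotZr n a (u v : 'cV[R]_n) : dot u (a *: v) = a * dot u v.
Proof. by rewrite /dot -scalemxAr mxE. Qed.

Lemma dotDl n (u v w : 'cV[R]_n) : dot (v + w) u = dot v u + dot w u.
Proof. by rewrite dotC dotDr !(dotC u). Qed.

Lemma dotZl n a (u v : 'cV[R]_n) : dot (a *: u) v = a * dot u v.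
Proof. by rewrite dotC dotZr dotC. Qed.

Lemma dot0r n (u : 'cV[R]_n) : dot u 0 = 0.
Proof. by rewrite /dot mulmx0 mxE. Qed.

Lemma dot_mulmxl m n (A : 'M[R]_(m, n)) u v : dot (A *m u) v = dot u (A^T *m v).
Proof. by rewrite /dot trmx_mul mulmxA. Qed.

Lemma dot_ge0 n (u : 'cV[R]_n) : 0 <= dot u u.
Proof. by rewrite dotE; apply: sumr_ge0 => k _; rewrite -expr2 sqr_ge0. Qed.

Lemma dot_eq0 n (u : 'cV[R]_n) : dot u u = 0 -> u = 0.
Proof.
rewrite dotE => u0; apply/colP => k; rewrite mxE; apply/eqP; rewrite -sqrf_eq0 expr2.
by rewrite (psumr_eq0P _ u0)// => i _; rewrite -expr2 sqr_ge0.
Qed.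

Lemma dot_gt0 n (u : 'cV[R]_n) : u != 0 -> 0 < dot u u.
Proof.
by move=> u0; rewrite lt_neqAle dot_ge0 andbT eq_sym; apply: contraNneq u0 => /dot_eq0 ->.
Qed.

Lemma quadformE n (A : 'M[R]_n) v : quadform A v = dot v (A *m v).
Proof. by rewrite /quadform /dot mulmxA. Qed.

Lemma quadformD n (A B : 'M[R]_n) v : quadform (A + B) v = quadform A v + quadform B v.
Proof. by rewrite !quadformE mulmxDl dotDr. Qed.

Lemma quadformZ n a (A : 'M[R]_n) v : quadform (a *: A) v = a * quadform A v.
Proof. by rewrite !quadformE -scalemxAl dotZr. Qed.

Lemma quadform_sum n I (r : seq I) P (A : I -> 'M[R]_n) v :
  quadform (\sum_(i <- r | P i) A i) v = \sum_(i <- r | P i) quadform (A i) v.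
Proof.
apply: (big_morph (fun A => quadform A v)) => [A1 A2|]; first exact: quadformD.
by rewrite /quadform mulmx0 mul0mx mxE.
Qed.

Lemma quadform_conj m n (A : 'M[R]_n) (C : 'M[R]_(n, m)) v :
  quadform (C^T *m A *m C) v = quadform A (C *m v).
Proof. by rewrite !quadformE dot_mulmxl !mulmxA. Qed.

Lemma quadform_gram m n (C : 'M[R]_(n, m)) v :
  quadform (C *m C^T) v = dot (C^T *m v) (C^T *m v).
Proof. by rewrite quadformE dot_mulmxl trmxK mulmxA. Qed.

Lemma quadform_outer n (x v : 'cV[R]_n) : quadform (x *m x^T) v = dot x v ^+ 2.
Proof. by rewrite quadform_gram /dot mxE big_ord1 !mxE expr2. Qed.

Lemma quadform_scale n a (A : 'M[R]_n) v : quadform A (a *: v) = a ^+ 2 * quadform A v.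
Proof. by rewrite !quadformE -scalemxAr dotZl dotZr mulrA expr2. Qed.

Lemma dot_sym n (A : 'M[R]_n) u v : A^T = A -> dot u (A *m v) = dot v (A *m u).
Proof. by move=> sA; rewrite dotC dot_mulmxl sA. Qed.

Lemma quadform_comb n (A : 'M[R]_n) a u v : A^T = A ->
  quadform A (u + a *: v) =
  quadform A u + 2 * a * dot u (A *m v) + a ^+ 2 * quadform A v.
Proof.
move=> sA; rewrite !quadformE mulmxDr -scalemxAr !dotDr !dotDl !dotZr !dotZl.
by rewrite (dot_sym v u sA); ring.
Qed.

Lemma sym_eq_quadform n (A B : 'M[R]_n) : A^T = A -> B^T = B ->
  (forall v, quadform A v = quadform B v) -> A = B.
Proof.
move=> sA sB AB.
have dotAB u v : dot u (A *m v) = dot u (B *m v).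
  have := AB (u + 1 *: v); rewrite !quadform_comb// !AB; lra.
apply/matrixP => i j.
have := dotAB (delta_mx i 0) (delta_mx j 0).
by rewrite /dot !mulmxA trmx_delta -!rowE -!colE !mxE.
Qed.

(** Polarization; it turns convergence of the quadratic forms of symmetric matrices into convergence
    of their entries. *)
Lemma entry_quadform n (A : 'M[R]_n) i j : A^T = A ->
  A i j = (quadform A (delta_mx i 0 + delta_mx j 0) - quadform A (delta_mx i 0)
           - quadform A (delta_mx j 0)) / 2.
Proof.
move=> sA; have := quadform_comb 1 (delta_mx i 0) (delta_mx j 0) sA.
rewrite scale1r => ->.
rewrite (_ : dot _ _ = A i j); last first.
  by rewrite /dot !mulmxA trmx_delta -!rowE -!colE !mxE.
by field.
Qed.

(** Along [v + a *: (A *m v)] the form is a nonnegative polynomial in [a] without constant term, so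
    its linear coefficient, twice the squared norm of [A *m v], vanishes. *)
Lemma possemidef_ker n (A : 'M[R]_n) v :
  possemidefmx A -> quadform A v = 0 -> A *m v = 0.
Proof.
move=> [sA A0] Av0; apply: dot_eq0.
have wP a : 0 <= 2 * a * dot (A *m v) (A *m v) + a ^+ 2 * quadform A (A *m v).
  have := A0 (v + a *: (A *m v)); rewrite quadform_comb// Av0 add0r.
  by rewrite dot_mulmxl sA.
apply/eqP; rewrite eq_le dot_ge0 andbT leNgt; apply/negP.
have : 0 <= quadform A (A *m v) by exact: A0.
move: wP; set d := dot _ _; set q := quadform _ _ => wP q0 d0; clearbody d q => {A0 Av0 sA v A}.
(* The minimizer would be [- d / q]; the denominator [q + 1] also covers [q = 0] and still gives a
   negative value. *)
have := wP (- d / (q + 1)); apply/negP; rewrite -ltNge.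
rewrite (_ : _ + _ = - (d ^+ 2 * (q + 2)) / (q + 1) ^+ 2); last by field; lra.
by rewrite mulNr oppr_lt0 divr_gt0 ?mulr_gt0 ?exprn_gt0//; lra.
Qed.

Lemma posdef_sym n (A : 'M[R]_n) : posdefmx A -> A^T = A. Proof. by case. Qed.

Lemma posdef_possemidef n (A : 'M[R]_n) : posdefmx A -> possemidefmx A.
Proof.
move=> [sA A0]; split=> // v; have [->|/A0/ltW//] := eqVneq v 0.
by rewrite quadformE mulmx0 dot0r.
Qed.

Lemma possemidef_unit_posdef n (A : 'M[R]_n) :
  possemidefmx A -> A \in unitmx -> posdefmx A.
Proof.
move=> pA uA; split=> [|v v0]; first by case: pA.
rewrite lt_neqAle (pA.2 v) andbT; apply: contraNneq v0 => /esym/(possemidef_ker pA).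
by move=> /(congr1 (mulmx (invmx A))); rewrite mulKmx// mulmx0 => ->.
Qed.

Lemma posdef_unit n (A : 'M[R]_n) : posdefmx A -> A \in unitmx.
Proof.
move=> pA; rewrite unitmxE unitfE; apply/negP => /det0P[v v0 vA].
have := pA.2 v^T; rewrite trmx_eq0 => /(_ v0).
by rewrite /quadform trmxK vA mul0mx mxE ltxx.
Qed.

Lemma posdefD n (A B : 'M[R]_n) : posdefmx A -> possemidefmx B -> posdefmx (B + A).
Proof.
move=> [sA A0] [sB B0]; split=> [|v v0]; first by rewrite linearD/= sA sB.
by rewrite quadformD ltr_wpDl// A0.
Qed.

Lemma posdefZ n a (A : 'M[R]_n) : 0 < a -> posdefmx A -> posdefmx (a *: A).
Proof.
move=> a0 [sA A0]; split=> [|v v0]; first by rewrite linearZ/= sA.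
by rewrite quadformZ mulr_gt0// A0.
Qed.

Lemma posdef_conj n m (A : 'M[R]_n) (C : 'M[R]_(n, m)) : posdefmx A ->
  (forall v : 'cV[R]_m, C *m v = 0 -> v = 0) -> posdefmx (C^T *m A *m C).
Proof.
move=> [sA A0] injC; split=> [|v v0]; first by rewrite !trmx_mul trmxK sA mulmxA.
by rewrite quadform_conj A0//; apply: contraNneq v0 => /injC ->.
Qed.

Lemma sym_invmx n (A : 'M[R]_n) : A^T = A -> (invmx A)^T = invmx A.
Proof. by move=> sA; rewrite trmx_inv sA. Qed.

Lemma quadform_invmx n (A : 'M[R]_n) v : posdefmx A ->
  quadform (invmx A) v = quadform A (invmx A *m v).
Proof.
move=> pA; have uA := posdef_unit pA.
by rewrite !quadformE mulKVmx// dotC.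
Qed.

Lemma posdef_inv n (A : 'M[R]_n) : posdefmx A -> posdefmx (invmx A).
Proof.
move=> pA; have uA := posdef_unit pA; split=> [|v v0].
  exact/sym_invmx/posdef_sym.
rewrite quadform_invmx// pA.2//; apply: contraNneq v0 => /(congr1 (mulmx A)).
by rewrite mulKVmx// mulmx0 => ->.
Qed.

(* Legendre duality; equality holds at [v = invmx B *m x]. *)
Lemma quadform_dual n (B : 'M[R]_n) x v : posdefmx B ->
  2 * dot x v - quadform B v <= quadform (invmx B) x.
Proof.
move=> pB; have uB := posdef_unit pB.
have := (posdef_possemidef pB).2 (v + (-1) *: (invmx B *m x)).
rewrite quadform_comb ?posdef_sym// mulKVmx// -quadform_invmx// (dotC v x); lra.
Qed.

(** This is [quadform_dual] at the best multiple of [v]. *)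
Lemma cauchy_posdef n (B : 'M[R]_n) x v : posdefmx B ->
  dot x v ^+ 2 <= quadform (invmx B) x * quadform B v.
Proof.
move=> pB; have [->|v0] := eqVneq v 0.
  by rewrite dot0r expr0n/= (quadformE B) mulmx0 dot0r mulr0.
have B0 := pB.2 v v0; have := quadform_dual x ((dot x v / quadform B v) *: v) pB.
rewrite dotZr quadform_scale.
rewrite (_ : _ - _ = dot x v ^+ 2 / quadform B v); first by rewrite ler_pdivrMr.
by field; lra.
Qed.

Definition loewner_le {n} (A B : 'M[R]_n) := forall v, quadform A v <= quadform B v.

Lemma loewner_le_trans n (B A C : 'M[R]_n) :
  loewner_le A B -> loewner_le B C -> loewner_le A C.
Proof. by move=> AB BC v; exact: le_trans (AB v) (BC v). Qed.

(** The dual bound for [A] is tested at [invmx B *m x], where the one for [B] is an equality. *)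
Lemma loewner_le_inv n (A B : 'M[R]_n) : posdefmx A -> posdefmx B ->
  loewner_le A B -> loewner_le (invmx B) (invmx A).
Proof.
move=> pA pB AB x; have := quadform_dual x (invmx B *m x) pA.
have := AB (invmx B *m x); rewrite -quadform_invmx// -quadformE; lra.
Qed.

Lemma invmx_scale_posdef n a (A : 'M[R]_n) : 0 < a -> posdefmx A ->
  invmx (a *: A) = a^-1 *: invmx A.
Proof. by move=> a0 pA; rewrite invmxZ// posdef_unit//; exact: posdefZ. Qed.

End QuadraticForms.

(** * Cholesky factorization, traces and log-determinants *)

Section Cholesky.
Context {R : realType}.

(** Induction on the size, through the Schur complement of the top left entry. *)
Lemma cholesky n (A : 'M[R]_n) : posdefmx A ->
  exists2 C : 'M[R]_n, is_trig_mx C & A = C *m C^T.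
Proof.
elim: n A => [|n IH] A pA; first by exists 0; [apply/is_trig_mxP; case|apply/matrixP; case].
move: A pA; rewrite -[n.+1]/(1 + n)%N => A pA.
pose a := A 0 0; pose b := dlsubmx A; pose D := drsubmx A.
have a0 : 0 < a.
  have := pA.2 (delta_mx 0 0); rewrite quadformE /dot trmx_delta mulmxA -rowE -colE !mxE.
  by apply; apply/eqP => /matrixP/(_ 0 0)/eqP; rewrite !mxE eqxx oner_eq0.
have EA : A = block_mx a%:M b^T b D.
  rewrite -[LHS]submxK -/b -/D; congr block_mx.
    by apply/matrixP => i j; rewrite !mxE !ord1 eqxx mulr1n; congr (A _ _); apply: val_inj.
  by rewrite /b trmx_dlsub (posdef_sym pA).
(* [A] maps the columns of [U] to vectors with first coordinate 0, so the congruence by [U] yields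
   the Schur complement and keeps it positive definite. *)
pose U : 'M[R]_(1 + n, n) := col_mx (- a^-1 *: b^T) 1%:M.
have ES : D - a^-1 *: (b *m b^T) = U^T *m A *m U.
  rewrite EA /U tr_col_mx trmx1 [(_ *: b^T)^T]linearZ/= trmxK.
  rewrite mul_row_block mul_row_col !mul1mx mulmx1.
  rewrite -!scalemxAl -!scalemxAr scalemxAl mul_mx_scalar scalerA mulNr mulVf ?gt_eqF//.
  by rewrite scaleN1r addNr scaler0 mul0mx add0r scaleNr addrC.
have [|C tC EC] := IH (D - a^-1 *: (b *m b^T)).
  rewrite ES; apply: posdef_conj => // v; rewrite /U mul_col_mx mul1mx.
  by rewrite -(col_mx0 R 1 n 1) => /eq_col_mx[].
exists (block_mx (Num.sqrt a)%:M 0 ((Num.sqrt a)^-1 *: b) C).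
  by rewrite is_trig_block_mx// eqxx tC scalar_mx_is_trig.
have sa0 : Num.sqrt a != 0 by rewrite gt_eqF// sqrtr_gt0.
rewrite EA tr_block_mx trmx0 tr_scalar_mx linearZ/= mulmx_block.
rewrite !mul0mx !mulmx0 !addr0 -EC -scalar_mxM -expr2 sqr_sqrtr ?ltW//.
rewrite mul_scalar_mx mul_mx_scalar !scalerA mulfV// !scale1r.
rewrite -scalemxAl -scalemxAr scalerA -invfM -expr2 sqr_sqrtr ?ltW//.
by rewrite addrC subrK.
Qed.

Lemma posdef_det_gt0 n (A : 'M[R]_n) : posdefmx A -> 0 < \det A.
Proof.
move=> pA; have uA := posdef_unit pA; have [C _ EA] := cholesky pA.
rewrite lt_neqAle eq_sym -unitfE -unitmxE uA/= EA det_mulmx det_tr -expr2.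
exact: sqr_ge0.
Qed.

(** Through [cholesky], trace inequalities against a positive definite matrix reduce to inequalities
    between quadratic forms. *)
Lemma trace_quadform m n (A : 'M[R]_n) (C : 'M[R]_(n, m)) :
  \tr (A *m (C *m C^T)) = \sum_j quadform A (col j C).
Proof.
rewrite mulmxA mxtrace_mulC mulmxA; apply: eq_bigr => j _.
by rewrite /quadform tr_col colE mulmxA -!row_mul -colE [RHS]mxE [RHS]mxE.
Qed.

Lemma trace_outer n (A : 'M[R]_n) (x : 'cV[R]_n) :
  \tr (A *m (x *m x^T)) = quadform A x.
Proof. by rewrite trace_quadform big_ord1 col_id. Qed.

Lemma trace_le n (A B T : 'M[R]_n) : posdefmx T -> loewner_le A B ->
  \tr (A *m T) <= \tr (B *m T).
Proof.
move=> /cholesky[C _ ->] AB; rewrite !trace_quadform.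
by apply: ler_sum => j _; exact: AB.
Qed.

Lemma trace_posdef_ge0 n (A T : 'M[R]_n) : posdefmx T -> possemidefmx A ->
  0 <= \tr (A *m T).
Proof.
move=> /cholesky[C _ ->] [_ A0]; rewrite trace_quadform.
by apply: sumr_ge0 => j _; exact: A0.
Qed.

(** Cauchy-Schwarz for each column of a Cholesky factor of [A], summed over the columns. *)
Lemma quadform_le_trace n (A B : 'M[R]_n) v : posdefmx A -> posdefmx B ->
  quadform A v <= \tr (invmx B *m A) * quadform B v.
Proof.
move=> /cholesky[C _ ->] pB; rewrite trace_quadform quadform_gram dotE mulr_suml.
apply: ler_sum => j _; rewrite -expr2.
rewrite (_ : _ 0 = dot (col j C) v) ?cauchy_posdef//.
by rewrite /dot tr_col -row_mul [RHS]mxE.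
Qed.

Lemma loewner_le_scale n (A B : 'M[R]_n) : posdefmx A -> posdefmx B ->
  exists2 c, 1 <= c & loewner_le A (c *: B).
Proof.
(* The trace alone is a valid factor; the added 1 ensures [1 <= c]. *)
move=> pA pB; exists (1 + \tr (invmx B *m A)) => [|v].
  by rewrite lerDl; apply: trace_posdef_ge0 => //; exact/posdef_possemidef/posdef_inv.
rewrite quadformZ; apply: le_trans (quadform_le_trace v pA pB) _.
by rewrite ler_wpM2r ?lerDr//; exact: (posdef_possemidef pB).2.
Qed.

Lemma ln_le_subr1 (x : R) : 0 < x -> ln x <= x - 1.
Proof. by move=> x0; have := @le_ln1Dx R (x - 1); rewrite addrCA subrr addr0; apply; lra. Qed.

Lemma ln_eq_subr1 (x : R) : 0 < x -> ln x = x - 1 -> x = 1.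
Proof.
move=> x0 lx; apply/eqP; apply: contraT => x1.
have := @expR_gt1Dx R (ln x); rewrite lnK// lx addrCA subrr addr0 ltxx.
by apply; rewrite subr_eq0.
Qed.

Lemma ln_prod (I : finType) (f : I -> R) : (forall i, 0 < f i) ->
  ln (\prod_i f i) = \sum_i ln (f i).
Proof.
move=> f0; suff [] : 0 < \prod_i f i /\ ln (\prod_i f i) = \sum_i ln (f i) by [].
elim/big_rec2 : _ => [|i z y _ [y0 <-]]; first by rewrite ltr01 ln1.
by rewrite mulr_gt0// lnM// posrE.
Qed.

(** With [A = C *m C^T], the gap is the sum over the rows of [g i]: the squares off the diagonal
    plus [y - 1 - ln y] at [y = C i i ^+ 2], all nonnegative. A zero gap makes [C] diagonal with
    entries of square 1. *)
Lemma ln_det_le_eq n (A : 'M[R]_n) : posdefmx A ->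
  ln (\det A) <= \tr A - n%:R /\ (\tr A - n%:R <= ln (\det A) -> A = 1%:M).
Proof.
move=> pA; have dA := posdef_det_gt0 pA.
have [C tC EA] := cholesky pA.
have C0 i : 0 < C i i ^+ 2.
  rewrite exprn_even_gt0//=; move: dA; rewrite EA det_mulmx det_tr det_trig//.
  by apply: contraTneq => Ci0; rewrite (bigD1 i)//= Ci0 !mul0r ltxx.
pose g i := \sum_(j | j != i) C i j ^+ 2 + (C i i ^+ 2 - 1 - ln (C i i ^+ 2)).
have s0 i : 0 <= \sum_(j | j != i) C i j ^+ 2 by apply: sumr_ge0 => j _; exact: sqr_ge0.
have l0 i : 0 <= C i i ^+ 2 - 1 - ln (C i i ^+ 2) by rewrite subr_ge0 ln_le_subr1.
have g0 i : 0 <= g i by rewrite addr_ge0.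
have Eg : \tr A - n%:R - ln (\det A) = \sum_i g i.
  rewrite [in ln _]EA det_mulmx det_tr det_trig// -big_split/=.
  rewrite ln_prod; last by move=> i; rewrite -expr2.
  rewrite -[in n%:R](card_ord n) -sumr_const -!sumrB; apply: eq_bigr => i _.
  rewrite /g -expr2 {1}EA !mxE (bigD1 i)//= !mxE -expr2.
  under eq_bigr do rewrite mxE -expr2.
  by ring.
split; first by rewrite -subr_ge0 Eg; exact: sumr_ge0.
rewrite -subr_le0 Eg => sg; have {}sg : \sum_i g i = 0.
  by apply/eqP; rewrite eq_le sg sumr_ge0.
have gi i : g i = 0 by apply: (psumr_eq0P _ sg).
have Cii i : C i i ^+ 2 = 1.
  by apply: ln_eq_subr1 => //; have := gi i; have := s0 i; have := l0 i; rewrite /g; lra.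
have Cij i j : j != i -> C i j = 0.
  have : \sum_(j | j != i) C i j ^+ 2 = 0.
    by have := gi i; have := s0 i; have := l0 i; rewrite /g; lra.
  move=> S0 ji; apply/eqP; rewrite -sqrf_eq0; apply/eqP.
  by apply: (psumr_eq0P _ S0) => // k _; exact: sqr_ge0.
rewrite EA; apply/matrixP => i j; rewrite !mxE (bigD1 i)//= big1 ?addr0 => [|k ki].
  rewrite mxE; have [<-|ij] := eqVneq i j; first by rewrite -expr2 Cii.
  by rewrite [C j i]Cij// mulr0.
by rewrite Cij// mul0r.
Qed.

(** For [X = C *m C^T], the positive definite matrix [C^T *m Y *m C] has the trace of [X *m Y] and
    determinant [\det X * \det Y], so [ln_det_le_eq] applies to it. *)
Lemma ln_det_trace n (X Y : 'M[R]_n) : posdefmx X -> posdefmx Y ->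
  ln (\det X) + ln (\det Y) <= \tr (X *m Y) - n%:R /\
  (\tr (X *m Y) - n%:R <= ln (\det X) + ln (\det Y) -> X *m Y = 1%:M).
Proof.
move=> pX pY; have dX := posdef_det_gt0 pX; have dY := posdef_det_gt0 pY.
have [C _ EX] := cholesky pX.
have uC : C \in unitmx.
  by have := posdef_unit pX; rewrite EX unitmx_mul => /andP[].
have pZ : posdefmx (C^T *m Y *m C).
  by apply: posdef_conj => // v Cv; rewrite -[v](mulKmx uC) Cv mulmx0.
have [] := ln_det_le_eq pZ.
rewrite (_ : \det _ = \det X * \det Y); last first.
  by rewrite EX !det_mulmx; ring.
rewrite lnM// -mxtrace_mulC mulmxA -EX => le eq; split=> // /eq.
(* Two cyclic moves of factors turn [C^T *m Y *m C = 1%:M] into [X *m Y = 1%:M]. *)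
by rewrite -mulmxA => /mulmx1C; rewrite EX -!mulmxA; move/mulmx1C; rewrite -!mulmxA.
Qed.

(** Concavity of the log-determinant: its tangent at [B] lies above it. *)
Lemma ln_det_lipschitz n (A B : 'M[R]_n) : posdefmx A -> posdefmx B ->
  ln (\det A) <= ln (\det B) + \tr (A *m invmx B) - n%:R.
Proof.
move=> pA pB; have := (ln_det_trace pA (posdef_inv pB)).1.
rewrite det_inv lnV ?posrE ?posdef_det_gt0//; lra.
Qed.

End Cholesky.

(** * Monotonicity, contraction and descent of the iteration map *)

Section Iteration.
Context {R : realType} {K N : nat} (x : 'I_N -> 'cV[R]_K) (T : 'M[R]_K) (alpha0 : R).
Hypotheses (N_gt0 : (0 < N)%N) (x_neq0 : forall i, x i != 0)
  (T_posdef : posdefmx T) (alpha0_gt0 : 0 < alpha0).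

(** The sample part of the update, as a function of the inverse iterate. The selection [P] serves to
    separate the samples in the kernel of a limit of inverse iterates from the others. *)
Definition weighted_gram (P : pred 'I_N) (Q : 'M[R]_K) : 'M[R]_K :=
  ((1 + alpha0)^-1 * (K%:R / N%:R)) *:
    \sum_(i | P i) (quadform Q (x i))^-1 *: (x i *m (x i)^T).

Let B := (alpha0 / (1 + alpha0)) *: T.

Lemma LKL_stepE S : LKL_step x T alpha0 S = weighted_gram predT (invmx S) + B.
Proof. by []. Qed.

Lemma regularizer_posdef : posdefmx B.
Proof. by apply: posdefZ => //; rewrite divr_gt0// addr_gt0. Qed.

Lemma weight_ge0 : 0 <= (1 + alpha0)^-1 * (K%:R / N%:R).
Proof. by rewrite mulr_ge0 ?divr_ge0 ?invr_ge0// addr_ge0// ltW. Qed.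

Lemma quadform_weighted_gram P Q v : quadform (weighted_gram P Q) v =
  (1 + alpha0)^-1 * (K%:R / N%:R) *
    \sum_(i | P i) (quadform Q (x i))^-1 * dot (x i) v ^+ 2.
Proof.
rewrite quadformZ quadform_sum; congr (_ * _); apply: eq_bigr => i _.
by rewrite quadformZ quadform_outer.
Qed.

Lemma trace_weighted_gram P Q A : \tr (A *m weighted_gram P Q) =
  (1 + alpha0)^-1 * (K%:R / N%:R) *
    \sum_(i | P i) quadform A (x i) / quadform Q (x i).
Proof.
rewrite -scalemxAr mxtraceZ mulmx_sumr raddf_sum/=; congr (_ * _).
by apply: eq_bigr => i _; rewrite -scalemxAr mxtraceZ trace_outer mulrC.
Qed.

Lemma weighted_gram_possemidef P Q : possemidefmx Q -> possemidefmx (weighted_gram P Q).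
Proof.
move=> [_ Q0]; split=> [|v].
  rewrite linearZ/= raddf_sum/=; congr (_ *: _); apply: eq_bigr => i _.
  by rewrite linearZ/= trmx_mul trmxK.
rewrite quadform_weighted_gram mulr_ge0 ?weight_ge0//; apply: sumr_ge0 => i _.
by rewrite mulr_ge0 ?sqr_ge0// invr_ge0.
Qed.

Lemma weighted_gram_anti P Q Q' : posdefmx Q -> loewner_le Q Q' ->
  loewner_le (weighted_gram P Q') (weighted_gram P Q).
Proof.
move=> pQ QQ' v; rewrite !quadform_weighted_gram ler_wpM2l ?weight_ge0//.
apply: ler_sum => i _; rewrite ler_wpM2r ?sqr_ge0// lef_pV2 ?posrE ?pQ.2//.
by rewrite (lt_le_trans _ (QQ' _)) ?pQ.2.
Qed.

Lemma weighted_gramZ P a Q : weighted_gram P (a^-1 *: Q) = a *: weighted_gram P Q.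
Proof.
rewrite /weighted_gram [RHS]scalerA (mulrC a) -[RHS]scalerA; congr (_ *: _).
rewrite scaler_sumr; apply: eq_bigr => i _.
by rewrite quadformZ invfM invrK scalerA.
Qed.

Lemma LKL_step_posdef S : posdefmx S -> posdefmx (LKL_step x T alpha0 S).
Proof.
move=> pS; apply: posdefD; first exact: regularizer_posdef.
exact/weighted_gram_possemidef/posdef_possemidef/posdef_inv.
Qed.

Lemma LKL_step_mono S S' : posdefmx S -> posdefmx S' -> loewner_le S S' ->
  loewner_le (LKL_step x T alpha0 S) (LKL_step x T alpha0 S').
Proof.
move=> pS pS' SS' v; rewrite !LKL_stepE !quadformD lerD2r.
by apply: weighted_gram_anti; [exact: posdef_inv|exact: loewner_le_inv].
Qed.

Lemma LKL_step_scale a S : 0 < a -> posdefmx S ->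
  LKL_step x T alpha0 (a *: S) = a *: LKL_step x T alpha0 S + (1 - a) *: B.
Proof.
move=> a0 pS; rewrite !LKL_stepE invmx_scale_posdef// weighted_gramZ.
by rewrite scalerDr scalerBl scale1r -addrA [_ + (B - _)]addrC subrK.
Qed.

Section FixedPoint.
Context (S : 'M[R]_K) (d : R).
Hypotheses (S_posdef : posdefmx S) (S_fix : LKL_step x T alpha0 S = S)
  (d_gt0 : 0 < d) (dB : loewner_le (d *: S) B).

Lemma LKL_step_upper a A : 1 <= a -> posdefmx A -> loewner_le A (a *: S) ->
  loewner_le (LKL_step x T alpha0 A) ((1 + (1 - d) * (a - 1)) *: S).
Proof.
move=> a1 pA AS; have a0 : 0 < a by rewrite (lt_le_trans ltr01).
apply: loewner_le_trans (LKL_step_mono pA (posdefZ a0 S_posdef) AS) _ => v.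
(* The image of [a *: S] is [a *: S - (a - 1) *: B], and [B] dominates [d *: S]. *)
rewrite LKL_step_scale// S_fix quadformD !(quadformZ _ S) (quadformZ _ B).
have := dB v; rewrite (quadformZ _ S) => dBv.
have : 0 <= (a - 1) * (quadform B v - d * quadform S v) by rewrite mulr_ge0 ?subr_ge0.
lra.
Qed.

Lemma LKL_step_lower b A : 0 < b -> b <= 1 -> posdefmx A -> loewner_le (b *: S) A ->
  loewner_le ((1 - (1 - d) * (1 - b)) *: S) (LKL_step x T alpha0 A).
Proof.
move=> b0 b1 pA SA.
apply: loewner_le_trans (LKL_step_mono (posdefZ b0 S_posdef) pA SA) => v.
rewrite LKL_step_scale// S_fix quadformD !(quadformZ _ S) (quadformZ _ B).
have := dB v; rewrite (quadformZ _ S) => dBv.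
have : 0 <= (1 - b) * (quadform B v - d * quadform S v) by rewrite mulr_ge0 ?subr_ge0.
lra.
Qed.

Lemma LKL_iter_sandwich a b A t : d <= 1 -> 1 <= a -> 0 < b -> b <= 1 -> posdefmx A ->
  loewner_le A (a *: S) -> loewner_le (b *: S) A ->
  let At := iter t (LKL_step x T alpha0) A in
  [/\ posdefmx At, loewner_le At ((1 + (1 - d) ^+ t * (a - 1)) *: S)
    & loewner_le ((1 - (1 - d) ^+ t * (1 - b)) *: S) At].
Proof.
move=> d1 a1 b0 b1 pA AS SA; have r0 k : 0 <= (1 - d) ^+ k by rewrite exprn_ge0 ?subr_ge0.
have r1 k : (1 - d) ^+ k <= 1 by rewrite exprn_ile1 ?subr_ge0// gerBl ltW.
elim: t => [|t [pAt AtS SAt]] /=.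
  by rewrite expr0 !mul1r; split=> //; rewrite ?subKr// addrCA subrr addr0.
split; first exact: LKL_step_posdef.
- rewrite (_ : _ + _ = 1 + (1 - d) * (1 + (1 - d) ^+ t * (a - 1) - 1)).
    by apply: LKL_step_upper => //; rewrite lerDl mulr_ge0 ?subr_ge0.
  by rewrite exprS; ring.
- rewrite (_ : _ - _ = 1 - (1 - d) * (1 - (1 - (1 - d) ^+ t * (1 - b)))).
    apply: LKL_step_lower => //; last by rewrite gerBl mulr_ge0 ?subr_ge0.
    (* The lower coefficient never falls below [b], hence stays positive. *)
    have : (1 - d) ^+ t * (1 - b) <= 1 * (1 - b) by rewrite ler_wpM2r ?subr_ge0.
    lra.
  by rewrite exprS; ring.
Qed.

End FixedPoint.

Lemma LKL_step_trace S A : \tr (A *m LKL_step x T alpha0 S) =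
  (1 + alpha0)^-1 * (K%:R / N%:R * (\sum_i quadform A (x i) / quadform (invmx S) (x i))
     + alpha0 * \tr (A *m T)).
Proof.
rewrite LKL_stepE mulmxDr mxtraceD trace_weighted_gram -scalemxAr mxtraceZ; ring.
Qed.

(** Replacing the sample logarithms by their tangents at [S] majorizes the objective. Up to a
    constant, the majorant at [A] is [1 + alpha0] times [ln (\det A) + \tr (invmx A *m S')], minimal
    at [S']; its decrease is the gap of [ln_det_trace] for [invmx S] and [S']. *)
Lemma LKL_step_descent S : posdefmx S ->
  let S' := LKL_step x T alpha0 S in
  LKL x T alpha0 S' <= LKL x T alpha0 S /\
  (LKL x T alpha0 S <= LKL x T alpha0 S' -> S' = S).
Proof.
move=> pS S'; have pS' : posdefmx S' := LKL_step_posdef pS.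
have uS := posdef_unit pS; have uS' := posdef_unit pS'.
have [le eq] := ln_det_trace (posdef_inv pS) pS'.
have a1 : 1 + alpha0 != 0 by rewrite gt_eqF// addr_gt0.
(* Against [invmx S] every sample ratio is 1, so the samples contribute exactly [K]. *)
have tr1 : (1 + alpha0) * \tr (invmx S *m S') = K%:R + alpha0 * \tr (invmx S *m T).
  rewrite LKL_step_trace mulVKf//; congr (_ + _).
  rewrite (eq_bigr (fun=> 1)) => [|i _]; last by rewrite divff// gt_eqF// (posdef_inv pS).2.
  by rewrite sumr_const card_ord divfK// pnatr_eq0 -lt0n.
(* Against its own inverse the new iterate has trace [K]; this evaluates the majorant at [S']. *)
have tr2 := LKL_step_trace S (invmx S').
move: (tr2); rewrite mulVmx// mxtrace1 => {}tr2.
have sum_le : K%:R / N%:R * (\sum_i ln (quadform (invmx S') (x i))) <=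
    K%:R / N%:R * (\sum_i ln (quadform (invmx S) (x i)))
    + K%:R / N%:R * (\sum_i quadform (invmx S') (x i) / quadform (invmx S) (x i))
    - K%:R.
  have N0 : N%:R != 0 :> R by rewrite pnatr_eq0 -lt0n.
  rewrite -[X in _ - X](divfK N0) -mulrDr -mulrBr ler_wpM2l ?divr_ge0//.
  rewrite -[X in _ - X%:R](card_ord N) -sumr_const -big_split -sumrB; apply: ler_sum => i _ /=.
  have q0 := (posdef_inv pS).2 _ (x_neq0 i); have q0' := (posdef_inv pS').2 _ (x_neq0 i).
  have := ln_le_subr1 (divr_gt0 q0' q0); rewrite lnM ?posrE ?invr_gt0// lnV ?posrE//; lra.
have {}tr2 : (1 + alpha0) * K%:R = K%:R / N%:R *
   (\sum_i quadform (invmx S') (x i) / quadform (invmx S) (x i))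
     + alpha0 * \tr (invmx S' *m T).
  by rewrite [in LHS]tr2 mulVKf.
move: le eq; rewrite det_inv lnV ?posrE ?posdef_det_gt0// => le eq.
have gap : LKL x T alpha0 S' - LKL x T alpha0 S <=
    (1 + alpha0) * (- ln (\det S) + ln (\det S') - (\tr (invmx S *m S') - K%:R)).
  by rewrite /LKL; lra.
split.
  rewrite -subr_le0; apply: le_trans gap _.
  by rewrite pmulr_rle0 ?subr_le0// addr_gt0.
rewrite -subr_ge0 => /le_trans/(_ gap); rewrite pmulr_rge0 ?addr_gt0// subr_ge0 => /eq.
by move=> /(congr1 (mulmx S)); rewrite mulKVmx// mulmx1.
Qed.

(** The error vanishes as [a] and [b] tend to 1, which allows a passage to the limit along the
    iterates. The tangent bound at [A] controls the determinant, and [a^-1 *: invmx S <= invmx A]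
    the other terms. *)
Lemma LKL_ge_sandwich S A a b : posdefmx S -> posdefmx A -> 1 <= a -> 0 < b ->
  loewner_le A (a *: S) -> loewner_le (b *: S) A ->
  LKL x T alpha0 S - ((1 + alpha0) * K%:R * (b^-1 - 1) + K%:R * (a - 1)
     + alpha0 * (1 - a^-1) * \tr (invmx S *m T)) <= LKL x T alpha0 A.
Proof.
move=> pS pA a1 b0 AS SA; have a0 : 0 < a by rewrite (lt_le_trans ltr01).
have iAS : loewner_le (invmx A) (b^-1 *: invmx S).
  rewrite -invmx_scale_posdef//; apply: loewner_le_inv => //; exact: posdefZ.
have iSA : loewner_le (a^-1 *: invmx S) (invmx A).
  rewrite -invmx_scale_posdef//; apply: loewner_le_inv => //; exact: posdefZ.
have det_ge : ln (\det S) - K%:R * (b^-1 - 1) <= ln (\det A).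
  have := ln_det_lipschitz pS pA; have := trace_le pS iAS.
  rewrite -scalemxAl mxtraceZ mulVmx ?posdef_unit// mxtrace1 (mxtrace_mulC S); lra.
have sum_ge : K%:R / N%:R * (\sum_i ln (quadform (invmx S) (x i))) - K%:R * (a - 1) <=
    K%:R / N%:R * (\sum_i ln (quadform (invmx A) (x i))).
  have N0 : N%:R != 0 :> R by rewrite pnatr_eq0 -lt0n.
  suff : \sum_i ln (quadform (invmx S) (x i)) - N%:R * (a - 1) <=
      \sum_i ln (quadform (invmx A) (x i)).
    move=> /(ler_wpM2l (divr_ge0 (ler0n R K) (ler0n R N))).
    by rewrite mulrBr [_ * (N%:R * _)]mulrA divfK.
  rewrite mulr_natl -[X in _ *+ X](card_ord N) -sumr_const -sumrB; apply: ler_sum => i _ /=.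
  have q0 := (posdef_inv pS).2 _ (x_neq0 i); have q0' := (posdef_inv pA).2 _ (x_neq0 i).
  have := iSA (x i); rewrite quadformZ -ler_ln ?posrE ?mulr_gt0 ?invr_gt0//.
  rewrite lnM ?posrE ?invr_gt0// lnV ?posrE//; have := ln_le_subr1 a0; lra.
have tr_ge : alpha0 * (a^-1 * \tr (invmx S *m T)) <= alpha0 * \tr (invmx A *m T).
  by rewrite ler_pM2l// -mxtraceZ scalemxAl; exact: trace_le.
have := ler_wpM2l (ltW alpha0_gt0) det_ge.
rewrite /LKL; lra.
Qed.

End Iteration.

(** * Limits of matrices and of their quadratic forms *)

Section MatrixLimits.
Context {R : realType} {I : Type} (F : set_system I) {FF : ProperFilter F}.

Lemma cvg_mxP m n (A : I -> 'M[R]_(m, n)) (B : 'M[R]_(m, n)) :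
  A t @[t --> F] --> B <-> forall i j, A t i j @[t --> F] --> B i j.
Proof.
split=> [AB i j|AB P [Q BQ QP]].
  by move=> U BU; exact: AB (@coord_continuous R m n i j B U BU).
have : \forall t \near F, forall i j, Q i j (A t i j).
  by apply: filter_forall => i; apply: filter_forall => j; exact: AB.
by apply: filterS => t At; exact: QP.
Qed.

Lemma cvg_mulmx m n p (A : I -> 'M[R]_(m, n)) (B : I -> 'M[R]_(n, p))
    (A' : 'M[R]_(m, n)) (B' : 'M[R]_(n, p)) :
  A t @[t --> F] --> A' -> B t @[t --> F] --> B' -> A t *m B t @[t --> F] --> A' *m B'.
Proof.
move=> /cvg_mxP AA /cvg_mxP BB; apply/cvg_mxP => i j; rewrite mxE.
under eq_fun do rewrite mxE.
by apply: cvg_big => [|k _]; [exact: add_continuous|exact: cvgM].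
Qed.

Lemma cvg_trmx m n (A : I -> 'M[R]_(m, n)) (A' : 'M[R]_(m, n)) :
  A t @[t --> F] --> A' -> (A t)^T @[t --> F] --> A'^T.
Proof.
move=> /cvg_mxP AA; apply/cvg_mxP => i j; rewrite mxE.
by under eq_fun do rewrite mxE; exact: AA.
Qed.

Lemma cvg_quadform n (A : I -> 'M[R]_n) (A' : 'M[R]_n)
    (v : I -> 'cV[R]_n) (v' : 'cV[R]_n) :
  A t @[t --> F] --> A' -> v t @[t --> F] --> v' ->
  quadform (A t) (v t) @[t --> F] --> quadform A' v'.
Proof.
move=> AA vv; have := cvg_mulmx (cvg_mulmx (cvg_trmx vv) AA) vv.
by move=> /cvg_mxP; apply.
Qed.

Lemma cvg_mxtrace n (A : I -> 'M[R]_n) (A' : 'M[R]_n) :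
  A t @[t --> F] --> A' -> \tr (A t) @[t --> F] --> \tr A'.
Proof.
move=> /cvg_mxP AA; apply: cvg_big => [|i _]; [exact: add_continuous|exact: AA].
Qed.

(** The limit matrix is assembled from [l] by polarization. *)
Lemma cvg_sym_quadform n (A : I -> 'M[R]_n) (l : 'cV[R]_n -> R) :
  (forall t, (A t)^T = A t) -> (forall v, quadform (A t) v @[t --> F] --> l v) ->
  exists2 B : 'M[R]_n, B^T = B & A t @[t --> F] --> B.
Proof.
move=> sA Al; pose e i : 'cV[R]_n := delta_mx i 0.
exists (\matrix_(i, j) ((l (e i + e j) - l (e i) - l (e j)) / 2)).
  by apply/matrixP => i j; rewrite !mxE (addrC (e j)) addrAC.
apply/cvg_mxP => i j; rewrite mxE.
under eq_fun do rewrite (entry_quadform _ _ (sA _)).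
by apply: cvgMr_tmp; apply: cvgB; first apply: cvgB.
Qed.

Lemma cvg_loewner_squeeze n (A : I -> 'M[R]_n) (S : 'M[R]_n) (a b : I -> R) :
  (forall t, (A t)^T = A t) -> S^T = S ->
  (forall t, loewner_le (A t) (a t *: S)) -> (forall t, loewner_le (b t *: S) (A t)) ->
  a t @[t --> F] --> (1 : R) -> b t @[t --> F] --> (1 : R) -> A t @[t --> F] --> S.
Proof.
move=> sA sS Aa bA a1 b1.
have Al v : quadform (A t) v @[t --> F] --> quadform S v.
  apply: (@squeeze_cvgr _ _ _ _ (fun t => b t * quadform S v) (fun t => a t * quadform S v)).
  - by near=> t; have := Aa t v; have := bA t v; rewrite !quadformZ => -> ->.
  - by rewrite -[X in _ --> X]mul1r; exact: cvgMr_tmp.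
  - by rewrite -[X in _ --> X]mul1r; exact: cvgMr_tmp.
have [B sB AB] := cvg_sym_quadform sA Al.
suff <- : B = S by [].
apply: sym_eq_quadform => // v; apply: (cvg_unique _ _ (Al v)); first exact: norm_hausdorff.
by apply: cvg_quadform => //; exact: cvg_cst.
Unshelve. all: by end_near. Qed.

End MatrixLimits.

(** * Monotone limits, rank factorization and kernels of semidefinite matrices *)

Section SemidefiniteLimits.
Context {R : realType}.

(** Each quadratic form decreases and is bounded below by 0, hence converges. *)
Lemma possemidef_cvg n (A : nat -> 'M[R]_n) : (forall t, possemidefmx (A t)) ->
  (forall t, loewner_le (A t.+1) (A t)) ->
  exists2 B : 'M[R]_n, possemidefmx B & A t @[t --> \oo] --> B.
Proof.
move=> pA dA.
have cA v : cvgn (fun t => quadform (A t) v).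
  apply: nonincreasing_is_cvgn; first by apply/nonincreasing_seqP => t; exact: dA.
  by exists 0 => _ [t _ <-]; exact: (pA t).2.
have [B sB AB] := cvg_sym_quadform (fun t => (pA t).1) cA.
exists B => //; split=> // v.
have : quadform (A t) v @[t --> \oo] --> quadform B v.
  by apply: cvg_quadform => //; exact: cvg_cst.
by move=> /cvgr_to_ge; apply; near=> t; exact: (pA t).2.
Unshelve. all: by end_near. Qed.

(** [Q] is compressed to its column space, where it becomes positive definite and has a Cholesky
    factor. *)
Lemma possemidef_factor n (Q : 'M[R]_n) : possemidefmx Q ->
  exists r (C : 'M[R]_(n, r)) (C' : 'M[R]_(r, n)),
    [/\ r = \rank Q, Q = C *m C^T & C' *m C = 1%:M].
Proof.
move=> pQ; have sQ := pQ.1; have /row_fullP[B' B'B] := col_base_full Q.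
set B := col_base Q in B' B'B; pose S := (B'^T)^T *m Q *m B'^T.
have EQ : Q = B *m S *m B^T.
  (* [B *m B'] is a projection onto the column space of [Q]. *)
  have BBQ : B *m B' *m Q = Q.
    rewrite -[X in _ *m X](mulmx_base Q) mulmxA -(mulmxA B) B'B mulmx1.
    exact: mulmx_base.
  rewrite /S trmxK !mulmxA BBQ -mulmxA -trmx_mul.
  by rewrite -[X in _ = X *m _]sQ -trmx_mul BBQ sQ.
have pS : posdefmx S.
  apply: possemidef_unit_posdef.
    split=> [|v]; first by rewrite /S !trmx_mul !trmxK sQ mulmxA.
    by rewrite quadform_conj; exact: pQ.2.
  (* [Q] factors through [S], so [S] has at least the rank of [Q], which is its size. *)
  rewrite -row_free_unit -row_leq_rank {1}EQ.
  exact: leq_trans (mxrankM_maxl _ _) (mxrankM_maxr _ _).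
have [H _ ES] := cholesky pS.
have uH : H \in unitmx by have := posdef_unit pS; rewrite ES unitmx_mul => /andP[].
exists (\rank Q), (B *m H), (invmx H *m B'); split=> //.
  by rewrite trmx_mul mulmxA -(mulmxA B) -ES.
by rewrite mulmxA -(mulmxA _ B') B'B mulmx1 mulVmx.
Qed.

(** With [Q = C *m C^T], the trace is the sum of the forms of [M] at the [\rank Q] columns of [C].
    The column [j] is [Q *m v] for [v = C'^T *m e], and [quadform Q v] is the squared norm of the
    unit vector [e]. *)
Lemma trace_le_rank n (Q M : 'M[R]_n) : possemidefmx Q ->
  (forall v, quadform M (Q *m v) <= quadform Q v) -> \tr (Q *m M) <= (\rank Q)%:R.
Proof.
move=> /possemidef_factor[r [C [C' [<- EQ C'C]]]] QMQ.
rewrite mxtrace_mulC EQ trace_quadform -[X in X%:R]card_ord -sumr_const.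
apply: ler_sum => j _; pose e : 'cV[R]_r := delta_mx j 0.
have CC' : C^T *m (C'^T *m e) = e by rewrite mulmxA -trmx_mul C'C trmx1 mul1mx.
have := QMQ (C'^T *m e); rewrite EQ quadform_gram CC' -mulmxA CC' -colE.
by rewrite /dot trmx_delta mul_delta_mx [in X in _ <= X]mxE !eqxx.
Qed.

(** This translates matrix kernels into the subspaces of the sample condition; counting samples
    takes only the inclusion and the upper bound on the dimension. *)
Lemma kernel_vspace n (Q : 'M[R]_n) : exists V : {vspace 'cV[R]_n},
  (\dim V <= n - \rank Q)%N /\ (forall x, Q *m x = 0 -> x \in V).
Proof.
pose M := row_base (kermx Q^T).
exists <<[seq (row j M)^T | j <- enum 'I_(\rank (kermx Q^T))]>>%VS; split.
  by apply: leq_trans (dim_span _) _; rewrite size_map size_enum_ord mxrank_ker mxrank_tr.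
move=> x Qx; have : (x^T <= M)%MS.
  by rewrite eq_row_base; apply/sub_kermxP; rewrite -trmx_mul Qx trmx0.
move=> /submxP[D xD]; rewrite -[x]trmxK xD mulmx_sum_row raddf_sum/=.
apply: memv_suml => j _; rewrite linearZ/=; apply/memvZ/memv_span.
by apply: map_f; rewrite mem_enum.
Qed.

End SemidefiniteLimits.

Lemma quadform_continuous (R : realType) n (v : 'cV[R]_n) :
  continuous (fun A : 'M[R]_n => quadform A v).
Proof.
move=> S; apply: (cvg_quadform (F := nbhs S) (A := id) (v := fun=> v)) => //.
exact: cvg_cst.
Qed.

(** * Existence of a fixed point from the subspace condition *)

Section FixedPointExistence.
Context {R : realType} {K N : nat} (x : 'I_N -> 'cV[R]_K) (T : 'M[R]_K) (alpha0 : R).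
Hypotheses (N_gt0 : (0 < N)%N) (x_neq0 : forall i, x i != 0)
  (T_posdef : posdefmx T) (alpha0_gt0 : 0 < alpha0)
  (subspace_cond : forall V : {vspace 'cV[R]_K}, (1 <= \dim V <= K - 1)%N ->
       sample_proportion x V < (1 + alpha0) * (\dim V)%:R / K%:R).

Local Notation F := (LKL_step x T alpha0).
Local Notation B := ((alpha0 / (1 + alpha0)) *: T).
Local Notation c := ((1 + alpha0)^-1 * (K%:R / N%:R)).

Lemma kernel_count_lt (Q : 'M[R]_K) : (\rank Q < K)%N ->
  c * (\sum_(i | Q *m x i == 0) 1) < K%:R - (\rank Q)%:R.
Proof.
move=> rK; have [V [dV kerV]] := kernel_vspace Q.
have a1 : 0 < 1 + alpha0 by rewrite addr_gt0.
have K0 : (0 < K)%N := leq_ltn_trans (leq0n _) rK.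
have KR0 : 0 < K%:R :> R by rewrite ltr0n.
have NR0 : 0 < N%:R :> R by rewrite ltr0n.
rewrite -natrB ?(ltnW rK)//.
have dVR : (\dim V)%:R <= (K - \rank Q)%:R :> R by rewrite ler_nat.
have countV : \sum_(i | Q *m x i == 0) (1 : R) <= \sum_i (x i \in V)%:R.
  rewrite big_mkcond; apply: ler_sum => i _; case: eqP => [/kerV -> //|_].
  exact: ler0n.
have countN : \sum_(i | Q *m x i == 0) (1 : R) <= N%:R.
  apply: le_trans countV _; rewrite -[X in _ <= X%:R]card_ord -sumr_const.
  by apply: ler_sum => i _; case: (_ \in _).
(* In dimension 0 the count is empty because the samples are nonzero. *)
have [/eqP V0|V_gt0] := posnP (\dim V).
  rewrite big_pred0 ?mulr0 ?ltr0n ?subn_gt0// => i.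
  apply/negbTE; apply/eqP => /kerV; move: V0; rewrite dimv_eq0 => /eqP ->.
  by rewrite memv0; apply/negP.
rewrite -mulrA mulrC ltr_pdivrMr//; have [VK|KV] := leqP (\dim V) (K - 1).
  have := subspace_cond (V := V); rewrite V_gt0 VK => /(_ isT).
  rewrite /sample_proportion ltr_pdivlMr// => lt.
  have := ler_wpM2l (divr_ge0 (ler0n R K) (ler0n R N)) countV.
  have := ler_wpM2l (ltW a1) dVR; lra.
(* Here [V] is the whole space and [Q] has rank 0; a proportion at most 1 suffices since
   [1 + alpha0] exceeds 1. *)
have {}KV : K%:R <= (\dim V)%:R :> R.
  by rewrite ler_nat; move: KV; rewrite ltn_subLR// add1n ltnS.
have := ler_wpM2l (divr_ge0 (ler0n R K) (ler0n R N)) countN; rewrite divfK ?gt_eqF//.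
have : K%:R * (1 + alpha0) <= (K - \rank Q)%:R * (1 + alpha0).
  by rewrite ler_wpM2r ?(ltW a1)// (le_trans KV).
have := mulr_gt0 KR0 alpha0_gt0; lra.
Qed.

Lemma cvg_weighted_gram (P : pred 'I_N) (Q : nat -> 'M[R]_K) (Q' : 'M[R]_K) :
  Q t @[t --> \oo] --> Q' -> (forall i, P i -> quadform Q' (x i) != 0) ->
  weighted_gram x alpha0 P (Q t) @[t --> \oo] --> weighted_gram x alpha0 P Q'.
Proof.
move=> QQ' P0; apply: cvgZl_tmp.
apply: cvg_big => [|i Pi]; first exact: add_continuous.
apply: cvgZr_tmp; apply: cvgV; first exact: P0.
by apply: cvg_quadform => //; exact: cvg_cst.
Qed.

Let S t := iter t F B.
Let Q t := invmx (S t).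

Let S_posdef t : posdefmx (S t).
Proof.
elim: t => [|t IH]; first exact: regularizer_posdef.
exact: LKL_step_posdef.
Qed.

Let S_incr t : loewner_le (S t) (S t.+1).
Proof.
elim: t => [v|t IH]; last first.
  exact: (LKL_step_mono T x_neq0 alpha0_gt0 (S_posdef _) (S_posdef _) IH).
rewrite /S/= LKL_stepE quadformD lerDr.
exact: (weighted_gram_possemidef _ alpha0_gt0 _ (posdef_possemidef (posdef_inv (S_posdef 0)))).2.
Qed.

Let Q_possemidef t : possemidefmx (Q t).
Proof. exact/posdef_possemidef/posdef_inv. Qed.

Let Q_decr t : loewner_le (Q t.+1) (Q t).
Proof. exact: loewner_le_inv. Qed.

Lemma limit_unit (Q' : 'M[R]_K) : possemidefmx Q' -> Q t @[t --> \oo] --> Q' ->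
  Q' \in unitmx.
Proof.
move=> pQ' QQ'; rewrite -row_free_unit -row_leq_rank leqNgt; apply/negP => rK.
(* The weights of the samples selected by [P] converge, their limit forms being nonzero; the other
   weights are unbounded and are only estimated inside a trace. *)
pose P := [pred i | Q' *m x i != 0].
have P0 i : P i -> quadform Q' (x i) != 0.
  by move=> /= Pi; apply: contraNneq Pi => /(possemidef_ker pQ') ->.
pose M t := weighted_gram x alpha0 P (Q t) + B.
pose M' := weighted_gram x alpha0 P Q' + B.
have MM' : M t @[t --> \oo] --> M'.
  by apply: cvgD; [exact: cvg_weighted_gram|exact: cvg_cst].
have QS' : Q t.+1 @[t --> \oo] --> Q' by rewrite cvg_shiftS.
have splitS t : S t.+1 = weighted_gram x alpha0 (predC P) (Q t) + M t.
  rewrite {1}/S/= LKL_stepE addrA /weighted_gram -scalerDr; congr (_ *: _ + _).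
  by rewrite (bigID P) /= addrC.
have MS t : loewner_le (M t) (S t.+1).
  move=> v; rewrite splitS quadformD lerDr.
  exact: (weighted_gram_possemidef _ alpha0_gt0 _ (Q_possemidef t)).2.
have := kernel_count_lt rK; apply/negP; rewrite -leNgt lerBlDr -lerBlDl.
(* The trace of [Q' *m M'] is at least [K] minus the kernel contribution and at most [\rank Q'],
   against [kernel_count_lt]. *)
apply: (@le_trans _ _ (\tr (Q' *m M'))).
  have : \tr (Q t.+1 *m M t) @[t --> \oo] --> \tr (Q' *m M').
    by apply: cvg_mxtrace; exact: cvg_mulmx.
  move/cvgr_to_ge; apply; near=> t.
  have : \tr (Q t.+1 *m S t.+1) = K%:R by rewrite mulVmx ?posdef_unit// mxtrace1.
  rewrite splitS mulmxDr mxtraceD trace_weighted_gram => trK; rewrite -[X in X - _]trK.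
  rewrite lerBlDr addrC lerD2l ler_wpM2l ?weight_ge0//.
  rewrite [leRHS](eq_bigl (predC P)) => [|i]; last by rewrite /= negbK.
  (* As [Q] decreases, each ratio of its forms at steps [t.+1] and [t] is at most 1. *)
  apply: ler_sum => i _; rewrite ler_pdivrMr ?mul1r ?(posdef_inv (S_posdef t)).2//.
  exact: Q_decr.
apply: trace_le_rank => // v.
have l1 : quadform (M t) (Q t.+1 *m v) @[t --> \oo] --> quadform M' (Q' *m v).
  by apply: cvg_quadform => //; apply: cvg_mulmx => //; exact: cvg_cst.
have l2 : quadform (Q t.+1) v @[t --> \oo] --> quadform Q' v.
  by apply: cvg_quadform => //; exact: cvg_cst.
apply: (ler_cvg_to l1 l2); near=> t.
by rewrite quadform_invmx//; exact: MS.
Unshelve. all: by end_near. Qed.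

Lemma LKL_step_fixed_point : exists2 S', posdefmx S' & F S' = S'.
Proof.
have [Q' pQ' QQ'] := possemidef_cvg Q_possemidef Q_decr.
have uQ' := limit_unit pQ' QQ'; have {}pQ' := possemidef_unit_posdef pQ' uQ'.
have SS' : S t.+1 @[t --> \oo] --> F (invmx Q').
  rewrite LKL_stepE invmxK; apply: cvgD; last exact: cvg_cst.
  by apply: cvg_weighted_gram => // i _; rewrite gt_eqF// pQ'.2.
exists (invmx Q'); first exact: posdef_inv.
(* The limit of [S t.+1 *m Q t.+1 = 1%:M] shows that the image of [invmx Q'] is inverse to [Q']. *)
have SQ : F (invmx Q') *m Q' = 1%:M.
  have QS' : Q t.+1 @[t --> \oo] --> Q' by rewrite cvg_shiftS.
  apply: (cvg_unique _ (cvg_mulmx SS' QS')); first exact: norm_hausdorff.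
  rewrite (_ : (fun _ => _) = fun=> 1%:M); first exact: cvg_cst.
  by apply/funext => t; rewrite mulmxV ?posdef_unit.
by rewrite -[LHS](mulmxK uQ') SQ mul1mx.
Qed.

End FixedPointExistence.

(** * Behaviour at singular matrices, convergence of the iterates and minimality *)

Section Minimization.
Context {R : realType} {K N : nat} (x : 'I_N -> 'cV[R]_K) (T : 'M[R]_K) (alpha0 : R).
Hypotheses (N_gt0 : (0 < N)%N) (x_neq0 : forall i, x i != 0)
  (T_posdef : posdefmx T) (alpha0_gt0 : 0 < alpha0).

Local Notation F := (LKL_step x T alpha0).
Local Notation L := (LKL x T alpha0).

(** One half of the trace term absorbs the log-determinants and the other half is kept, while the
    sample terms are bounded below near [S]. *)
Lemma LKL_ge_trace (S : 'M[R]_K) : exists E : R, \forall A \near S, posdefmx A ->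
  E + alpha0 / 2 * \tr (invmx A *m T) <= L A.
Proof.
have a1 : 0 < 1 + alpha0 by rewrite addr_gt0.
(* Chosen with [(1 + alpha0) * s = alpha0 / 2], so that [ln_det_trace] for [invmx A] and [s *: T]
   costs half the trace term. *)
pose s := alpha0 / (2 * (1 + alpha0)).
have s0 : 0 < s by rewrite divr_gt0// mulr_gt0.
(* Once [quadform A (x i)] is below the denominator, [quadform_dual] at a multiple of [x i] gives
   this lower bound; the 1 leaves room for a neighborhood and keeps the denominator positive. *)
pose m i := dot (x i) (x i) ^+ 2 / (`|quadform S (x i)| + 1).
have m0 i : 0 < m i by rewrite divr_gt0 ?exprn_gt0 ?dot_gt0// ltr_wpDl.
exists ((1 + alpha0) * (ln (\det (s *: T)) + K%:R) + K%:R / N%:R * \sum_i ln (m i)).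
have near_lt i : \forall A \near S, quadform A (x i) < `|quadform S (x i)| + 1.
  have cvg_q : quadform A (x i) @[A --> S] --> quadform S (x i).
    exact: quadform_continuous.
  by move/cvgr_lt: cvg_q; apply; rewrite ltr_pwDr// ler_norm.
have : \forall A \near S, forall i, quadform A (x i) < `|quadform S (x i)| + 1.
  exact: (filter_forall (F := nbhs S) (f := fun i A =>
     quadform A (x i) < `|quadform S (x i)| + 1) _ near_lt).
apply: filterS => A Ax pA.
have det_ge : (1 + alpha0) * (ln (\det (s *: T)) + K%:R) - alpha0 / 2 * \tr (invmx A *m T)
    <= (1 + alpha0) * ln (\det A).
  have := (ln_det_trace (posdef_inv pA) (posdefZ s0 T_posdef)).1.
  rewrite det_inv lnV ?posrE ?posdef_det_gt0// -scalemxAr mxtraceZ => le.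
  have -> : alpha0 / 2 = (1 + alpha0) * s by rewrite /s; field; lra.
  by rewrite -mulrA -mulrBr ler_pM2l//; lra.
have sum_ge : K%:R / N%:R * \sum_i ln (m i) <=
    K%:R / N%:R * \sum_i ln (quadform (invmx A) (x i)).
  rewrite ler_wpM2l ?divr_ge0//; apply: ler_sum => i _.
  rewrite ler_ln ?posrE// ?(posdef_inv pA).2//.
  have := quadform_dual (x i) ((dot (x i) (x i) / (`|quadform S (x i)| + 1)) *: x i) pA.
  rewrite dotZr quadform_scale /m; have := Ax i.
  set q := _ + 1; set w := dot _ _ => Aq; apply: le_trans.
  have q0 : 0 < q by rewrite ltr_wpDl.
  have : (w / q) ^+ 2 * quadform A (x i) <= (w / q) ^+ 2 * q.
    by rewrite ler_wpM2l ?sqr_ge0// ltW.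
  have -> : (w / q) ^+ 2 * q = w ^+ 2 / q by field; lra.
  have -> : w / q * w = w ^+ 2 / q by field; lra.
  lra.
rewrite /LKL; lra.
Qed.

Lemma trace_inv_near_singular (S : 'M[R]_K) (G : R) : possemidefmx S -> ~ posdefmx S ->
  \forall A \near S, posdefmx A -> G <= \tr (invmx A *m T).
Proof.
move=> pS nS; have [v v0 Sv] : exists2 v, v != 0 & quadform S v = 0.
  apply: contrapT => H; apply: nS; split=> [|v v0]; first exact: pS.1.
  rewrite lt_neqAle pS.2 andbT; apply/eqP => Sv; apply: H; exists v => //.
pose p := quadform (invmx T) v; have p0 : 0 < p := (posdef_inv T_posdef).2 v v0.
pose w := dot v v; have w0 : 0 < w := dot_gt0 v0.
(* Chosen so that the linear term [2 * s * w] of the dual bound is [|G| * p + 1]; near [S] the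
   quadratic term costs at most 1, since the form of [S] vanishes at [v]. *)
pose s := (`|G| * p + 1) / (2 * w).
have s0 : 0 < s by rewrite divr_gt0 ?mulr_gt0// ltr_wpDl// mulr_ge0// ltW.
have cvg_q : quadform A v @[A --> S] --> quadform S v.
  exact: quadform_continuous.
have : \forall A \near S, quadform A v < (s ^+ 2)^-1.
  by move/cvgr_lt: cvg_q; apply; rewrite Sv invr_gt0 exprn_gt0.
apply: filterS => A Av pA.
have := quadform_dual v (s *: v) pA; rewrite dotZr quadform_scale -/w.
have -> : 2 * (s * w) = `|G| * p + 1 by rewrite /s; field; lra.
have : s ^+ 2 * quadform A v <= 1.
  by rewrite mulrC -ler_pdivlMr ?exprn_gt0// mul1r ltW.
have := quadform_le_trace v (posdef_inv pA) (posdef_inv T_posdef).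
rewrite invmxK mxtrace_mulC -/p => h1 h2 h3.
have : `|G| * p <= \tr (invmx A *m T) * p by lra.
by rewrite ler_pM2r//; apply: le_trans; exact: ler_norm.
Qed.

Lemma psd_extension_singular (S : 'M[R]_K) : possemidefmx S -> ~ posdefmx S ->
  psd_extension L S = +oo%E.
Proof.
move=> pS nS; rewrite /psd_extension memNset// limf_einfE; apply/eq_infty => M.
have [E LE] := LKL_ge_trace S.
(* This threshold for the trace turns the lower bound of [LKL_ge_trace] into [M]. *)
have GE := trace_inv_near_singular (2 * (M - E) / alpha0) pS nS.
apply: le_trans (ereal_sup_ubound _); last first.
  (* The lower limit is a supremum of infima over sets of the filter; this superlevel set is one of
     them. *)
  exists [set A | M <= L A] => //; rewrite /within/=.
  apply: filterS2 LE GE => A LA GA pA; apply: le_trans (LA pA).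
  rewrite -lerBlDl; apply: le_trans (ler_wpM2l _ (GA pA)); last by rewrite divr_ge0// ltW.
  by rewrite le_eqVlt; apply/orP; left; apply/eqP; field; rewrite gt_eqF.
by apply: le_ereal_inf_tmp => _ [A /= MA <-]; rewrite lee_fin.
Qed.

Section FixedPoint.
Context (S : 'M[R]_K).
Hypotheses (S_posdef : posdefmx S) (S_fix : F S = S).

Lemma LKL_iter_bounds A : posdefmx A -> exists a b : nat -> R,
  [/\ a t @[t --> \oo] --> (1 : R), b t @[t --> \oo] --> (1 : R) &
   forall t, [/\ 1 <= a t, 0 < b t, posdefmx (iter t F A),
     loewner_le (iter t F A) (a t *: S) & loewner_le (b t *: S) (iter t F A)]].
Proof.
move=> pA; have invle (a : R) (X Y : 'M[R]_K) : 1 <= a ->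
    loewner_le X (a *: Y) -> loewner_le (a^-1 *: X) Y.
  move=> a1 XY v; have := XY v; rewrite !quadformZ ler_pdivrMl//; lra.
have inv01 (a : R) : 1 <= a -> 0 < a^-1 /\ a^-1 <= 1.
  by move=> a1; rewrite invr_gt0 invf_le1// (lt_le_trans ltr01).
(* The rate is [d = e^-1] with [S <= e *: B]; as [1 <= e], the factor [1 - d] lies in [[0, 1)]. *)
have [e e1 /(invle _ _ _ e1) dB] :=
  loewner_le_scale S_posdef (regularizer_posdef T_posdef alpha0_gt0).
have [d0 d1] := inv01 _ e1.
have [a a1 Aa] := loewner_le_scale pA S_posdef.
have [b' b1 /(invle _ _ _ b1) bA] := loewner_le_scale S_posdef pA.
have [b0 {}b1] := inv01 _ b1.
set d := e^-1 in d0 d1 dB; set b := b'^-1 in b0 b1 bA.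
have r0 t : 0 <= (1 - d) ^+ t by rewrite exprn_ge0 ?subr_ge0.
have r1 t : (1 - d) ^+ t <= 1 by rewrite exprn_ile1 ?subr_ge0// gerBl ltW.
have rt : (1 - d) ^+ t @[t --> \oo] --> (0 : R).
  by apply: cvg_expr; rewrite ger0_norm ?subr_ge0// gtrBl.
exists (fun t => 1 + (1 - d) ^+ t * (a - 1)), (fun t => 1 - (1 - d) ^+ t * (1 - b)); split.
- rewrite -[X in _ --> X]addr0; apply: cvgD; first exact: cvg_cst.
  by rewrite -[X in _ --> X](mul0r (a - 1)); exact: cvgMr_tmp.
- rewrite -[X in _ --> X]subr0; apply: cvgB; first exact: cvg_cst.
  by rewrite -[X in _ --> X](mul0r (1 - b)); exact: cvgMr_tmp.
move=> t; have [pAt AtS SAt] := LKL_iter_sandwich x_neq0 T_posdef alpha0_gt0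
  S_posdef S_fix d0 dB t d1 a1 b0 b1 pA Aa bA.
split=> //; first by rewrite lerDl mulr_ge0 ?subr_ge0.
have : (1 - d) ^+ t * (1 - b) <= 1 * (1 - b) by rewrite ler_wpM2r ?subr_ge0.
lra.
Qed.

Lemma LKL_iter_cvg A : posdefmx A -> iter t F A @[t --> \oo] --> S.
Proof.
move=> /LKL_iter_bounds[a [b [a1 b1 ab]]].
by apply: (cvg_loewner_squeeze _ _ _ _ a1 b1) => [t||t|t];
  [have [_ _ []] := ab t|exact: posdef_sym|have [] := ab t|have [] := ab t].
Qed.

(** Descent keeps the values along the iterates of [A] below [L A], and [LKL_ge_sandwich] keeps them
    above [L S] up to an error tending to 0. *)
Lemma LKL_fixed_point_le A : posdefmx A -> L S <= L A.
Proof.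
move=> pA; have [a [b [a1 b1 ab]]] := LKL_iter_bounds pA.
have decr t : L (iter t F A) <= L A.
  elim: t => //= t; apply: le_trans; have [_ _ pAt _ _] := ab t.
  exact: (LKL_step_descent N_gt0 x_neq0 T_posdef alpha0_gt0 pAt).1.
pose err (u v : R) := (1 + alpha0) * K%:R * (v^-1 - 1) + K%:R * (u - 1)
     + alpha0 * (1 - u^-1) * \tr (invmx S *m T).
have err_cvg : err (a t) (b t) @[t --> \oo] --> err 1 1.
  apply: cvgD; first apply: cvgD.
  - apply: cvgZl_tmp; apply: cvgB; last exact: cvg_cst.
    by apply: cvgV => //; exact: oner_neq0.
  - by apply: cvgZl_tmp; apply: cvgB => //; exact: cvg_cst.
  - apply: cvgMr_tmp; apply: cvgZl_tmp; apply: cvgB; first exact: cvg_cst.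
    by apply: cvgV => //; exact: oner_neq0.
have err0 : err 1 1 = 0 by rewrite /err invr1 subrr; ring.
have : L S - err (a t) (b t) @[t --> \oo] --> L S - 0.
  by rewrite -err0; apply: cvgB => //; exact: cvg_cst.
rewrite subr0 => /cvgr_to_le; apply; near=> t; apply: le_trans (decr t).
by have [at1 bt0 pAt AtS SAt] := ab t; exact: LKL_ge_sandwich.
Unshelve. all: by end_near. Qed.

(** From [L A <= L S <= L (F A)] the step at [A] is not strictly decreasing, so [A] is a fixed
    point; its constant iterates converge to [S]. *)
Lemma LKL_minimum_eq A : posdefmx A -> L A <= L S -> A = S.
Proof.
move=> pA AS; have FA : F A = A.
  have [_] := LKL_step_descent N_gt0 x_neq0 T_posdef alpha0_gt0 pA; apply.
  by apply: le_trans AS (LKL_fixed_point_le _); exact: LKL_step_posdef.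
have := LKL_iter_cvg pA; rewrite (_ : (fun _ => _) = fun=> A); last first.
  by apply/funext; elim=> //= t ->.
move=> AS'; apply: (cvg_unique _ _ AS'); first exact: norm_hausdorff.
exact: cvg_cst.
Qed.

End FixedPoint.
End Minimization.

Theorem proposition18 (R : realType) (K N : nat) (x : 'I_N -> 'cV[R]_K)
    (T : 'M[R]_K) (alpha0 : R) (Sigma : nat -> 'M[R]_K)
    (N_gt0 : (0 < N)%N)
    (x_neq0 : forall i : 'I_N, x i != 0)
    (T_posdef : posdefmx T)
    (alpha0_gt0 : 0 < alpha0)
    (subspace_cond : forall V : {vspace 'cV[R]_K}, (1 <= \dim V <= K - 1)%N ->
       sample_proportion x V < (1 + alpha0) * (\dim V)%:R / K%:R)
    (Sigma0_posdef : posdefmx (Sigma 0%N))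
    (Sigma_step : forall t : nat, Sigma t.+1 = LKL_step x T alpha0 (Sigma t)) :
  exists Sigmastar : 'M[R]_K,
    [/\ is_global_minimizer possemidefmx
          (psd_extension (LKL x T alpha0)) Sigmastar,
        forall S : 'M[R]_K,
          is_global_minimizer possemidefmx (psd_extension (LKL x T alpha0)) S ->
          S = Sigmastar
      & Sigma t @[t --> \oo] --> Sigmastar].
Proof.
have [S pS FS] := LKL_step_fixed_point N_gt0 x_neq0 T_posdef alpha0_gt0 subspace_cond.
have ext A : posdefmx A -> psd_extension (LKL x T alpha0) A = (LKL x T alpha0 A)%:E.
  by move=> pA; rewrite /psd_extension mem_set.
exists S; split.
- split=> [|A psA]; first exact: posdef_possemidef.
  have [pA|nA] := pselect (posdefmx A).
    by rewrite !ext// lee_fin; exact: LKL_fixed_point_le.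
  by rewrite (psd_extension_singular x_neq0 T_posdef alpha0_gt0 psA nA)// leey.
- move=> A [psA /(_ S (posdef_possemidef pS))]; have [pA|nA] := pselect (posdefmx A).
    by rewrite !ext// lee_fin; exact: LKL_minimum_eq.
  (* A singular minimizer would have value [+oo], above the finite value at [S]. *)
  by rewrite (psd_extension_singular x_neq0 T_posdef alpha0_gt0 psA nA)// ext.
- rewrite (_ : Sigma = fun t => iter t (LKL_step x T alpha0) (Sigma 0%N)); last first.
    by apply/funext; elim=> //= t <-.
  exact: LKL_iter_cvg.
Qed.
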